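(* Let $\mathcal{M}$ be the ideal on $\bigsqcup_{n\geq1}K_n$ defined in the context and let $\mathcal{S}$ be Solecki's ideal on $\Omega$. There is an $\mathcal{M}$-positive set $X$ (i.e. $X\notin\mathcal{M}$) such that $\mathcal{S}\leq_{RK}\mathcal{M}\upharpoonright X$.
   Context: The ideal $\mathcal{M}$: for $n\geq1$ let $K_n$ be the set of all functions from $n=\{0,\dots,n-1\}$ to $2n=\{0,\dots,2n-1\}$; these sets are pairwise disjoint. For $i<2n$ let $\hat{i}=\{f\in K_n:i\notin\mathrm{range}(f)\}$. For $A\subseteq K_n$ let $\psi_n(A)$ be the least $r$ such that there is $b\subseteq\{0,\dots,2n-1\}$ with $|b|=r$ and $A\subseteq\bigcup_{i\in b}\hat{i}$. For $A\subseteq\bigcup_{n\geq1}K_n$ let $\psi(A)=\sup_n\psi_n(A\cap K_n)$, and $\mathcal{M}=\{A:\psi(A)<\infty\}$. For $X\notin\mathcal{M}$, $\mathcal{M}\upharpoonright X=\{A\subseteq X:A\in\mathcal{M}\}$, an ideal on $X$. Solecki's ideal: $\Omega$ is the countable set of all clopen subsets of $2^{\mathbb{N}}$ of measure $1/2$ with respect to the product measure on $2^{\mathbb{N}}$ (each factor $2$ carrying the uniform probability measure). $\mathcal{S}$ is the ideal on $\Omega$ generated by the sets $E_x=\{a\in\Omega:x\in a\}$, $x\in2^{\mathbb{N}}$, i.e. $A\in\mathcal{S}$ iff $A\subseteq E_{x_1}\cup\dots\cup E_{x_k}$ for some $x_1,\dots,x_k\in2^{\mathbb{N}}$. Rudin-Keisler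 order: for ideals $\mathcal{I}$ on a countable set $Y$ and $\mathcal{J}$ on a countable set $X$, $\mathcal{I}\leq_{RK}\mathcal{J}$ iff there is $f:X\to Y$ such that $\mathcal{I}=\{A\subseteq Y:f^{-1}(A)\in\mathcal{J}\}$. *)

(* Defs.v *)
From HB Require Import structures.
From mathcomp Require Import all_boot all_order all_algebra.
From mathcomp Require Import all_classical all_reals all_analysis.
From mathcomp Require Import zify ring lra.

Set Implicit Arguments.
Unset Strict Implicit.
Unset Printing Implicit Defensive.

Import Order.TTheory GRing.Theory Num.Theory.
Import numFieldNormedType.Exports.

Local Open Scope classical_set_scope.
Local Open Scope ring_scope.

(* The trace of an ideal on X, as a family of subsets of the subtype X. *)
Definition restrict_ideal (T : Type) (I : set (set T)) (X : set T) :
    set (set X) :=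
  [set A : set X | I (set_val @` A)].
Arguments restrict_ideal {T} I X.

Definition RK_le (Y X : Type) (I : set (set Y)) (J : set (set X)) : Prop :=
  exists f : X -> Y, I = [set A : set Y | J (f @^-1` A)].

Definition K (n : nat) := {ffun 'I_n -> 'I_(2 * n)}.

(* The disjoint union of the K n for n >= 1: the tag n stands for n.+1. The case
   n = 0 is excluded because K 0 is a singleton not covered by any avoid i. *)
Definition bigK := {n : nat & K n.+1}.

Definition avoid (n : nat) (i : 'I_(2 * n)) : {set K n} :=
  [set f : K n | i \notin codom f]%SET.

Definition covered_by (n : nat) (A : {set K n}) (r : nat) : bool :=
  [exists b : {set 'I_(2 * n)},
     (#|b| == r) && (A \subset (\bigcup_(i in b) avoid i)%SET)].

Lemma covered_byT (n : nat) (A : {set K n.+1}) : exists r, covered_by A r.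
Proof.
exists #|[set: 'I_(2 * n.+1)]%SET|.
apply/existsP; exists [set: 'I_(2 * n.+1)]%SET.
rewrite eqxx /=; apply/fintype.subsetP => f _; apply/finset.bigcupP.
suff /existsP[i fi] : [exists i, i \notin codom f] by exists i; rewrite inE.
apply: contraT => /existsPn fN.
have /subset_leq_card : [set: 'I_(2 * n.+1)]%SET \subset codom f.
  by apply/fintype.subsetP => i _; apply: negbNE; exact: fN.
rewrite cardsT card_ord => /leq_trans/(_ (card_size _)).
by rewrite size_codom card_ord; lia.
Qed.

Definition psi_n (n : nat) (A : {set K n.+1}) : nat := ex_minn (covered_byT A).

Definition slice (A : set bigK) (n : nat) : {set K n.+1} :=
  [set f : K n.+1 | (Tagged (fun n => K n.+1) f : bigK) \in A]%SET.

Definition psi (R : realType) (A : set bigK) : \bar R :=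
  ereal_sup (range (fun n => ((psi_n (slice A n))%:R%:E : \bar R))).
Arguments psi : clear implicits.

Definition idealM (R : realType) : set (set bigK) :=
  [set A | (psi R A < +oo)%E].
Arguments idealM : clear implicits.

(* The product sigma-algebra on [cantor_space]. *)
Definition coord_preimages : set (set cantor_space) :=
  \bigcup_i preimage_set_system setT (fun x : cantor_space => x i) measurable.

Definition cantor_meas := g_sigma_algebraType coord_preimages.

(* The finite-dimensional rectangles form a pi-system generating the product
   sigma-algebra, so this property determines mu. *)
Definition is_product_measure (R : realType) (P : nat -> probability bool R)
    (mu : probability cantor_meas R) : Prop :=
  forall (n : nat) (A : nat -> set bool),
    mu [set x : cantor_space | forall i, (i < n)%N -> A i (x i)] =
    (\prod_(i < n) P i (A i))%E.

(* Existence of the product of fair coins: it is the distribution of the binary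
   digits under Lebesgue measure on [0, 1[. *)
Definition dyadic (R : realType) (m k : nat) : set R :=
  `[k%:R / 2 ^+ m, k.+1%:R / 2 ^+ m[.
Arguments dyadic : clear implicits.

Definition odd_dyadics (R : realType) (m : nat) : set R :=
  \bigcup_(k in [set k | odd k]) dyadic R m.+1 k.
Arguments odd_dyadics : clear implicits.

Definition binary_digits (R : realType) (x : measurableTypeR R) : cantor_meas :=
  (fun m : nat => x \in odd_dyadics R m) : cantor_space.

Lemma dyadicP (R : realType) (m k : nat) (x : R) :
  dyadic R m k x <-> k%:R <= x * 2 ^+ m < k.+1%:R.
Proof.
by rewrite /dyadic /= in_itv /= ler_pdivrMr ?ltr_pdivlMr ?exprn_gt0.
Qed.

Lemma dyadic_inj (R : realType) (m k l : nat) (x : R) :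
  dyadic R m k x -> dyadic R m l x -> k = l.
Proof.
move=> /dyadicP/andP[k1 k2] /dyadicP/andP[l1 l2].
have := le_lt_trans k1 l2; have := le_lt_trans l1 k2.
by rewrite !ltr_nat !ltnS => lk kl; apply/eqP; rewrite eqn_leq kl lk.
Qed.

Lemma binary_digitsE (R : realType) (m k : nat) (x : R) :
  dyadic R m.+1 k x -> (binary_digits x : cantor_space) m = odd k.
Proof.
move=> xk; rewrite /binary_digits; apply/idP/idP => [|ok].
  by rewrite inE => -[l /= ol xl]; rewrite (dyadic_inj xk xl).
by rewrite inE; exists k.
Qed.

Lemma dyadic_split (R : realType) (m k : nat) :
  dyadic R m k = dyadic R m.+1 k.*2 `|` dyadic R m.+1 k.*2.+1.
Proof.
have E0 : (k.*2%:R = 2 * k%:R :> R) by rewrite -mul2n natrM.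
have E1 : (k.*2.+1%:R = 2 * k%:R + 1 :> R) by rewrite -E0 natr1.
have E2 : (k.*2.+2%:R = 2 * k%:R + 2 :> R) by rewrite -E0 -[in RHS]natrD addn2.
have EX (x : R) : x * 2 ^+ m.+1 = 2 * (x * 2 ^+ m) by rewrite exprS; ring.
have EE := (E0, E1, E2, EX, esym (natr1 k : _ = _ :> R)).
apply/seteqP; split => [x /dyadicP|x [] /dyadicP]; rewrite !EE => /andP[k1 k2].
- by have [xk|xk] := ltP (x * 2 ^+ m.+1) (2 * k%:R + 1); rewrite EE in xk;
    [left|right]; apply/dyadicP; rewrite !EE; apply/andP; split; lra.
- by apply/dyadicP; rewrite EE; apply/andP; split; lra.
- by apply/dyadicP; rewrite EE; apply/andP; split; lra.
Qed.

Lemma measurable_dyadic (R : realType) (m k : nat) : measurable (dyadic R m k).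
Proof. exact: measurable_itv. Qed.

Lemma lebesgue_dyadic (R : realType) (m k : nat) :
  lebesgue_measure (dyadic R m k) = ((2 ^+ m)^-1)%:E.
Proof.
rewrite lebesgue_measure_itv /= lte_fin ltr_pM2r ?invr_gt0 ?exprn_gt0//.
rewrite ltr_nat ltnSn -EFinD; congr EFin.
by rewrite -natr1 mulrDl mul1r addrAC subrr add0r.
Qed.

Lemma measurable_binary_digits (R : realType) :
  measurable_fun setT (@binary_digits R).
Proof.
apply: (measurability (coord_preimages : set (set cantor_meas))) => // _
  [_ [i _ [B _ <-]] <-].
have mi : measurable_fun setT (fun x : R => (binary_digits x : cantor_space) i).
  apply: (measurable_fun_bool true); rewrite setTI.
  rewrite (_ : _ @^-1` _ = odd_dyadics R i).
    by apply: bigcup_measurable => k _; exact: measurable_dyadic.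
  by apply/seteqP; split => x; [exact: set_mem|exact: mem_set].
by have := mi measurableT B I; rewrite !setTI.
Qed.

Lemma fair_bernoulliE (R : realType) (B : set bool) :
  bernoulli_prob (2^-1 : R) B =
  (2^-1 * ((false \in B)%:R + (true \in B)%:R))%:E.
Proof.
rewrite /bernoulli_prob ifT; last by apply/andP; split; lra.
rewrite fsbig_mkcond setT_bool fsbigU//=; last by move=> x [/= ->].
rewrite !fsbig_set1 /= !patchE /bernoulli_pmf /=.
by do 2![case: ifPn => _]; rewrite -EFinD; congr EFin; rewrite /=; lra.
Qed.

Lemma lebesgue_binary_digits (R : realType) (n m k : nat) (A : nat -> set bool) :
  lebesgue_measure (dyadic R m k `&`
    [set x | forall i, (i < n)%N ->
       A i ((binary_digits x : cantor_space) (m + i)%N)]) =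
  (((2 ^+ m)^-1)%:E * \prod_(i < n) bernoulli_prob (2^-1 : R) (A i))%E.
Proof.
elim: n m k A => [|n IH] m k A.
  rewrite big_ord0 mule1 -(lebesgue_dyadic R m k); congr lebesgue_measure.
  by apply/seteqP; split => x // -[].
set S := [set x | _].
have mS : measurable S.
  rewrite (_ : S = \bigcap_(i in [set i | (i < n.+1)%N])
      ((fun x : R => (binary_digits x : cantor_space) (m + i)%N) @^-1` A i));
    last by apply/seteqP; split.
  apply: bigcap_measurableType => // i _.
  have mb := @measurable_binary_digits R.
  have := mb measurableT ((fun x : cantor_space => x (m + i)%N) @^-1` A i).
  rewrite setTI; apply; apply: sub_sigma_algebra.
  by exists (m + i)%N => //; exists (A i) => //; rewrite setTI.
have step l : lebesgue_measure (dyadic R m.+1 l `&` S) =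
    ((odd l \in A 0%N)%:R%:E * (((2 ^+ m.+1)^-1)%:E *
      \prod_(i < n) bernoulli_prob (2^-1 : R) (A i.+1)))%E.
  have [Al|Al] := boolP (odd l \in A 0%N).
    rewrite mul1e -(IH m.+1 l (fun i => A i.+1)); congr lebesgue_measure.
    apply/seteqP; split => x [xl xS]; split=> //.
      by move=> i ni; rewrite addSnnS; exact: xS.
    move=> [_|i ni]; last by rewrite -addSnnS; exact: xS.
    by rewrite addn0 (binary_digitsE xl); exact: set_mem.
  rewrite mul0e -[RHS](@measure0 _ _ _ lebesgue_measure); congr lebesgue_measure.
  rewrite -subset0 => x [xl /(_ 0%N isT)].
  by rewrite addn0 (binary_digitsE xl) => /mem_set; rewrite (negbTE Al).
have mSl l : measurable (dyadic R m.+1 l `&` S).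
  by apply: measurableI => //; exact: measurable_dyadic.
rewrite dyadic_split setIUl.
transitivity (lebesgue_measure (dyadic R m.+1 k.*2 `&` S) +
              lebesgue_measure (dyadic R m.+1 k.*2.+1 `&` S))%E.
  apply: measureU; [exact: mSl|exact: mSl|].
  apply/seteqP; split => x //= [[xk _] [xk' _]].
  by have := dyadic_inj xk xk' => /eqP; lia.
rewrite !step /= odd_double /= big_ord_recl fair_bernoulliE.
rewrite -ge0_muleDl ?lee_fin// -EFinD !muleA -!EFinM; congr (_%:E * _)%E.
by rewrite exprS invfM -[ord0 : nat]/0%N; ring.
Qed.

Definition unit_lebesgue (R : realType) : set (measurableTypeR R) -> \bar R :=
  mrestr lebesgue_measure (measurable_dyadic 0 0).

HB.instance Definition _ (R : realType) :=
  Measure.copy (@unit_lebesgue R)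
    (mrestr (@lebesgue_measure R) (measurable_dyadic 0 0)).

Lemma unit_lebesgueT (R : realType) : @unit_lebesgue R setT = 1%E.
Proof. by rewrite /unit_lebesgue /mrestr setTI lebesgue_dyadic expr0 invr1. Qed.

HB.instance Definition _ (R : realType) :=
  Measure_isProbability.Build _ _ R (@unit_lebesgue R) (@unit_lebesgueT R).

HB.instance Definition _ (R : realType) :=
  isMeasurableFun.Build _ _ (measurableTypeR R) _ (@binary_digits R)
    (@measurable_binary_digits R).

Lemma product_measure_fairP (R : realType) :
  exists mu : probability cantor_meas R,
    is_product_measure (fun _ => bernoulli_prob (2^-1 : R)) mu.
Proof.
exists (distribution (@unit_lebesgue R) (@binary_digits R)) => n A.
have := lebesgue_binary_digits R n 0 0 A.
by rewrite expr0 invr1 mul1e setIC.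
Qed.

(* The product measure on 2^nat; bernoulli_prob 2^-1 is the uniform probability
   on bool. *)
Definition fair_coin_measure (R : realType) : probability cantor_meas R :=
  sval (cid (product_measure_fairP R)).
Arguments fair_coin_measure : clear implicits.

Lemma fair_coin_measureP (R : realType) :
  is_product_measure (fun _ => bernoulli_prob (2^-1 : R)) (fair_coin_measure R).
Proof. exact: svalP. Qed.

Definition Omega (R : realType) : set (set cantor_space) :=
  [set a | clopen a /\ fair_coin_measure R a = (2^-1)%:E].
Arguments Omega : clear implicits.

Definition through (R : realType) (x : cantor_space) : set (Omega R) :=
  [set a : Omega R | set_val a x].
Arguments through : clear implicits.

Definition idealS (R : realType) : set (set (Omega R)) :=
  [set A | exists2 F : set cantor_space, finite_set F &
     A `<=` \bigcup_(x in F) through R x].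
Arguments idealS : clear implicits.

(* Main.v *)
Require Import Defs.
From mathcomp Require Import all_boot all_order all_algebra.
From mathcomp Require Import all_classical all_reals all_analysis.
From mathcomp Require Import zify lra.

Set Implicit Arguments.
Unset Strict Implicit.
Unset Printing Implicit Defensive.

Local Open Scope classical_set_scope.

Import Order.TTheory GRing.Theory Num.Theory.

(** The complement of the range of an injection from [n] to [2n] has exactly
    [n] elements.  When [2n = 2 ^ m], the points of [2n] name the binary words
    of length [m], so this complement names a union of [n] out of the [2n]
    cylinders of length [m]: a clopen set of measure 1/2.  Let [X] consist of
    all such injections, for all [m], and let the Rudin-Keisler map
    [half_clopen] send an injection to this clopen set.  An injection lies in
    [avoid i] exactly when its image under the map contains the points of the
    [i]-th cylinder, so covers by the sets [avoid i] at level [n] are the same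
    thing as covers by sets [through x], where [x] matters only through its
    first [m] digits.

    [X] is positive because any [n] points of [2n] lie in the range of some
    injection ([injections_positive]).

    If [A] is covered by [through x] for [x] in a finite set [F], then at each
    level the codes of the prefixes of the elements of [F] cover the preimage
    of [A] ([idealS_half_clopen]).

    Conversely, suppose that every level of the preimage of [A] is covered by
    at most [k] sets [avoid i].  Each [a] in [A] is determined by finitely many
    digits ([clopen_determined]), hence is the image of an injection at every
    large level ([Omega_missed_ex]), so that one of the [k] words [i] of each
    such level, extended by zeros, lies in [a].  The limits of the [k]
    resulting sequences along one free ultrafilter on the levels then meet
    every [a] in [A], because the ultrafilter selects one of the [k] sequences
    and [a] is closed
    ([half_clopen_idealS]). *)

(** * Binary words as natural numbers *)

(** Low-order digit first, so that the recursion follows the shift and [bits]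
    inverts the code at every length. *)
Fixpoint prefix_code (m : nat) (x : cantor_space) : nat :=
  if m is m'.+1 then (x 0 + (prefix_code m' (fun j => x j.+1)).*2)%N else 0%N.

Definition bits (c : nat) : cantor_space := fun j => odd (iter j half c).

Lemma bitsS (c j : nat) : bits c j.+1 = bits c./2 j.
Proof. by rewrite /bits iterSr. Qed.

Lemma prefix_code_lt (m : nat) (x : cantor_space) : (prefix_code m x < 2 ^ m)%N.
Proof.
elim: m x => [//|m IH] x /=.
by rewrite expnS; have := IH (fun j => x j.+1); case: (x 0%N) => /=; lia.
Qed.

Lemma bits_prefix_code (m : nat) (x : cantor_space) (j : nat) :
  (j < m)%N -> bits (prefix_code m x) j = x j.
Proof.
elim: m x j => [//|m IH] x [|j] /=.
  by rewrite /bits /= oddD odd_double addbF oddb.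
by rewrite ltnS => jm; rewrite bitsS half_bit_double IH.
Qed.

Lemma eq_prefix_code (m : nat) (x y : cantor_space) :
  (forall j, (j < m)%N -> x j = y j) -> prefix_code m x = prefix_code m y.
Proof.
elim: m x y => [//|m IH] x y xy /=; rewrite (xy 0%N)//; congr (_ + _.*2)%N.
by apply: IH => j jm; rewrite xy.
Qed.

Lemma prefix_code_bits (m c : nat) : (c < 2 ^ m)%N -> prefix_code m (bits c) = c.
Proof.
elim: m c => [[]//|m IH] c; rewrite expnS => cm /=.
rewrite (_ : (fun j => _) = bits c./2); last by apply/funext => j; rewrite bitsS.
by rewrite IH; [rewrite /bits /= odd_double_half|lia].
Qed.

(** * Clopen sets and limits in the Cantor space *)

Lemma nbhs_coord (x : cantor_space) (j : nat) :
  nbhs x [set y : cantor_space | y j = x j].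
Proof.
exact: (@proj_continuous nat (fun=> bool) j x [set b | b = x j]).
Qed.

Lemma nbhs_prefix_code (m : nat) (x : cantor_space) :
  nbhs x [set y : cantor_space | prefix_code m y = prefix_code m x].
Proof.
suff : nbhs x [set y : cantor_space | forall j, (j < m)%N -> y j = x j].
  by apply: filterS => y; exact: eq_prefix_code.
elim: m => [|m IH]; first by apply: filterE.
apply: filterS (filterI IH (nbhs_coord x m)) => y [yx ym] j.
by rewrite ltnS leq_eqVlt => /predU1P[->//|]; exact: yx.
Qed.

Lemma open_prefix_code (m : nat) (B : set nat) :
  open [set x : cantor_space | B (prefix_code m x)].
Proof.
rewrite openE => x Bx; rewrite /interior.
by apply: filterS (nbhs_prefix_code m x) => y /= ->.
Qed.

Lemma clopen_prefix_code (m : nat) (B : set nat) :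
  clopen [set x : cantor_space | B (prefix_code m x)].
Proof.
split; first exact: open_prefix_code.
by rewrite -openC; exact: (open_prefix_code m (~` B)).
Qed.

Lemma closed_coord (j : nat) (b : bool) :
  closed [set x : cantor_space | x j = b].
Proof.
rewrite -openC openE => x /= xb; rewrite /interior.
by apply: filterS (nbhs_coord x j) => y /= ->.
Qed.

(** Cluster points of [y] along [U] are what the proof uses of compactness:
    for an ultrafilter they are limits. *)
Lemma cantor_limit (U : set_system nat) (y : nat -> cantor_space) :
  ProperFilter U ->
  exists x, forall C : set cantor_space, closed C -> U (y @^-1` C) -> C x.
Proof.
move=> FU; have [x [_ xcl]] := @cantor_space_compact (y @ U) _ filterT.
by exists x => C cC UC; apply: cC => B; exact: xcl.
Qed.

(** Otherwise there are, for each [m], points inside and outside the set that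
    agree on their first [m] digits.  Limits of these two sequences along one
    ultrafilter have the same digits, hence coincide, although one lies in the
    set and the other in its complement, both of which are closed. *)
Lemma clopen_determined (a : set cantor_space) : clopen a ->
  exists m0, forall m, (m0 <= m)%N ->
    forall x y, prefix_code m x = prefix_code m y -> a x -> a y.
Proof.
move=> [oa ca].
suff [m0 am0] : exists m, forall x y,
    prefix_code m x = prefix_code m y -> a x -> a y.
  exists m0 => m m0m x y xy; apply: am0; apply: eq_prefix_code => j jm.
  have jm' := leq_trans jm m0m.
  by rewrite -(bits_prefix_code x jm') xy bits_prefix_code.
apply: contrapT => /forallNP aN.
have /choice[g gP] m : exists p : cantor_space * cantor_space,
    [/\ prefix_code m p.1 = prefix_code m p.2, a p.1 & ~ a p.2].
  have /existsNP[x /existsNP[y /not_implyP[xy /not_implyP[ax ay]]]] := aN m.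
  by exists (x, y).
have [U [UU ooU]] := ultraFilterLemma eventually_filter.
have [x xP] := @cantor_limit U (fst \o g) _.
have [y yP] := @cantor_limit U (snd \o g) _.
suff xy : x = y.
  have : (~` a) y.
    by apply: yP; [rewrite closedC|apply: filterE => m /=; have [] := gP m].
  by rewrite -xy; apply; apply: xP => //; apply: filterE => m /=; have [] := gP m.
apply/funext => j; apply: (xP [set z | z j = y j]); first exact: closed_coord.
(* The ultrafilter decides the [j]-th digit of the second sequence, and can only
   decide for that of its limit; the first sequence has the same digit. *)
have [|yN] := in_ultra_setVsetC [set m | (g m).2 j = y j] UU; last first.
  have : y j = ~~ y j.
    apply: (yP [set z | z j = ~~ y j]); first exact: closed_coord.
    by apply: filterS yN => m /= /eqP; case: (_ j); case: (y j).
  by case: (y j).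
apply: filter_app; apply: ooU; exists j.+1 => // m /= jm.
have [gm _ _] := gP m.
by rewrite -(bits_prefix_code (g m).1 jm) gm bits_prefix_code.
Qed.

(** * Measure of a union of cylinders *)

Section FairCoin.
Local Open Scope ring_scope.
Local Open Scope ereal_scope.
Context (R : realType).

Lemma measurable_prefix_code (m : nat) (c : nat) :
  measurable ([set x | prefix_code m x = c] : set cantor_meas).
Proof.
have [cm|cm] := ltnP c (2 ^ m); last first.
  rewrite (_ : mkset _ = set0)// -subset0 => x /= xc.
  by have := prefix_code_lt m x; rewrite xc ltnNge cm.
rewrite (_ : mkset _ = \bigcap_(i in [set i | (i < m)%N])
    ((fun x : cantor_space => x i) @^-1` [set bits c i])).
  apply: bigcap_measurableType => // i _; apply: sub_sigma_algebra.
  by exists i => //; exists [set bits c i] => //; rewrite setTI.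
apply/seteqP; split => x /= xc.
  by move=> i /= im; rewrite -xc bits_prefix_code.
by rewrite -[RHS](prefix_code_bits cm); exact: eq_prefix_code.
Qed.

Lemma fair_coin_measure_prefix_code1 (m c : nat) : (c < 2 ^ m)%N ->
  fair_coin_measure R [set x | prefix_code m x = c] = (2^-1 ^+ m)%:E.
Proof.
move=> cm; have := fair_coin_measureP R m (fun i => [set bits c i]).
rewrite (eq_bigr (fun=> (2^-1)%:E)); last first.
  move=> i _; apply: (etrans (fair_bernoulliE R _)); congr EFin.
  by rewrite !in_set1; case: (bits c i) => /=; lra.
rewrite prodEFin prodr_const card_ord => <-.
apply: (congr1 (fair_coin_measure R)); apply/seteqP; split => x /= xc.
  by move=> i /= im; rewrite -xc bits_prefix_code.
by rewrite -[RHS](prefix_code_bits cm); exact: eq_prefix_code.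
Qed.

Lemma fair_coin_measure_prefix_code (m N : nat) (B : {set 'I_N}) : (N = 2 ^ m)%N ->
  fair_coin_measure R [set x | exists2 i, i \in B & prefix_code m x = i] =
  (#|B|%:R * 2^-1 ^+ m)%:E.
Proof.
move=> Nm.
rewrite (_ : mkset _ =
    \big[setU/set0]_(i < N | i \in B) [set x | prefix_code m x = i]).
  rewrite measure_bigsetU_ord_cond; last 2 first.
  - by move=> i _; exact: measurable_prefix_code.
  - by move=> i j _ _ [x [/= -> /val_inj]].
  rewrite (eq_bigr (fun=> (2^-1 ^+ m)%:E)); last first.
    by move=> i _; apply: fair_coin_measure_prefix_code1; rewrite -Nm.
  by rewrite sumEFin sumr_const mulr_natl.
by rewrite -bigcup_pred; apply/seteqP; split => x [i]; exists i.
Qed.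
End FairCoin.

(** * Positivity as a bound on the size of covers *)

Definition covers (n : nat) (b : {set 'I_(2 * n.+1)}) (A : set bigK) : Prop :=
  forall f : K n.+1, A (existT _ n f) -> exists2 i, i \in b & i \notin codom f.

Lemma covered_byP (n r : nat) (A : set bigK) :
  reflect (exists2 b : {set 'I_(2 * n.+1)}, #|b| = r & covers b A)
    (Defs.covered_by (Defs.slice A n) r).
Proof.
apply: (iffP existsP) => [[b /andP[/eqP br /fintype.subsetP Ab]]|[b br Ab]];
  exists b => //.
  move=> f Af; have := Ab f; rewrite inE => /(_ (mem_set Af)) /finset.bigcupP.
  by move=> [i ib]; rewrite inE; exists i.
rewrite br eqxx; apply/fintype.subsetP => f; rewrite inE => /set_mem /Ab[i ib fi].
by apply/finset.bigcupP; exists i; rewrite ?inE.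
Qed.

(** Removes the suprema and minima from the definition of the ideal; the
    bound [k] is the integer part of the value of [psi]. *)
Lemma idealMP (R : realType) (A : set bigK) :
  idealM R A <-> exists k, forall n,
    exists2 b : {set 'I_(2 * n.+1)}, (#|b| <= k)%N & covers b A.
Proof.
rewrite /idealM /psi /=; split=> [Afin|[k Ak]].
  set s := ereal_sup _ in Afin.
  have ub n : (((psi_n (Defs.slice A n))%:R%:E : \bar R) <= s)%E.
    by apply: ereal_sup_ubound; exists n.
  have s0 : (0 <= s)%E by apply: le_trans (ub 0%N); rewrite lee_fin.
  have sfin : s \is a fin_num by rewrite ge0_fin_numE.
  exists (Num.truncn (fine s)) => n.
  have := ub n; rewrite -(fineK sfin) lee_fin -truncn_ge_nat;
    last exact: fine_ge0.
  rewrite /psi_n; case: ex_minnP => r /covered_byP[b <- Ab] _ rs.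
  by exists b.
apply: (@le_lt_trans _ _ k%:R%:E); last exact: ltry.
apply: ge_ereal_sup => _ [n _ <-]; rewrite lee_fin ler_nat.
have [b bk Ab] := Ak n.
rewrite /psi_n; case: ex_minnP => r _ rmin; apply: leq_trans bk; apply: rmin.
by apply/covered_byP; exists b.
Qed.

(** * From injections to half-measure clopen sets *)

Definition missed (n : nat) (f : K n.+1) : {set 'I_(2 * n.+1)} :=
  [set i | i \notin codom f]%SET.

Lemma card_missed (n : nat) (f : K n.+1) : injective f -> #|missed f| = n.+1.
Proof.
move=> finj; have := cardC (mem (codom f)).
rewrite card_codom// !card_ord.
rewrite (_ : #|predC _| = #|missed f|); first by lia.
by apply: eq_card => i; rewrite !inE.
Qed.

(** List the elements of [D] first and the others after them; the first
    [n.+1] entries of the list are the values of the injection. *)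
Lemma inj_codom_ex (n : nat) (D : {set 'I_(2 * n.+1)}) : (#|D| <= n.+1)%N ->
  exists2 f : K n.+1, injective f & {subset D <= codom f}.
Proof.
move=> Dn; pose i0 : 'I_(2 * n.+1) := Ordinal (isT : (0 < 2 * n.+1)%N).
pose e := enum D ++ enum (~: D)%SET.
have eu : uniq e.
  rewrite cat_uniq !enum_uniq andbT; apply/hasPn => i.
  by rewrite !mem_enum inE.
have es : size e = (2 * n.+1)%N by rewrite size_cat -!cardE cardsC card_ord.
exists [ffun i : 'I_n.+1 => nth i0 e i].
  move=> i j; rewrite !ffunE => /eqP; rewrite nth_uniq// ?es; last 2 first.
  - by have := ltn_ord i; lia.
  - by have := ltn_ord j; lia.
  by move=> /eqP/val_inj.
move=> i iD; have iD' : i \in enum D by rewrite mem_enum.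
have ilt : (index i (enum D) < n.+1)%N.
  by rewrite (leq_trans _ Dn)// cardE index_mem.
apply/codomP; exists (Ordinal ilt); rewrite ffunE /= nth_cat index_mem iD'.
by rewrite nth_index.
Qed.

(** The word length [m] for which [2 * n.+1 = 2 ^ m], at the levels [n] where
    there is one. *)
Definition depth (n : nat) : nat := trunc_log 2 (2 * n.+1).

Definition two_power (n : nat) : Prop := (2 * n.+1 = 2 ^ depth n)%N.

Lemma depth_predn (m : nat) : depth (2 ^ m).-1 = m.+1.
Proof. by rewrite /depth prednK ?expn_gt0// -expnS trunc_expnK. Qed.

Lemma two_power_predn (m : nat) : two_power (2 ^ m).-1.
Proof. by rewrite /two_power depth_predn prednK ?expn_gt0// expnS. Qed.

Definition region (n : nat) (B : {set 'I_(2 * n.+1)}) : set cantor_space :=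
  [set x | exists2 i, i \in B & prefix_code (depth n) x = i].

Lemma region_bits (n : nat) (B : {set 'I_(2 * n.+1)}) (i : 'I_(2 * n.+1)) :
  two_power n -> i \in B -> region B (bits i).
Proof. by move=> n2 iB; exists i => //; rewrite prefix_code_bits// -n2. Qed.

Section HalfClopen.
Context (R : realType).

Lemma fair_coin_measure_region (n : nat) (B : {set 'I_(2 * n.+1)}) : two_power n ->
  fair_coin_measure R (region B) = (2^-1)%:E <-> #|B| = n.+1.
Proof.
move=> n2; rewrite fair_coin_measure_prefix_code// exprVn -natrX -n2 natrM.
split=> [[]/eqP|->]; last first.
  by congr EFin; rewrite invfM mulrCA mulfV ?mulr1.
rewrite invfM mulrCA -[X in _ == X]mulr1 (inj_eq (mulfI _)) ?invr_eq0//.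
by rewrite -(inj_eq (mulIf (_ : n.+1%:R != 0)%R)) // mulfVK// mul1r eqr_nat => /eqP.
Qed.

Lemma Omega_missed (n : nat) (f : K n.+1) :
  two_power n -> injective f -> Omega R (region (missed f)).
Proof.
move=> n2 finj; split.
  exact: (@clopen_prefix_code _ [set c | exists2 i, _ & c = val i]).
by apply/fair_coin_measure_region => //; exact: card_missed.
Qed.

(** Once the level is deep enough to determine [a], exactly half of the words
    lie in [a], and any bijection of [n.+1] with the other half will do. *)
Lemma Omega_missed_ex (a : set cantor_space) : Omega R a ->
  exists m0, forall n, (m0 <= depth n)%N -> two_power n ->
    exists2 f : K n.+1, injective f & region (missed f) = a.
Proof.
move=> [/clopen_determined[m0 am0] aR]; exists m0 => n m0n n2.
pose B := [set i : 'I_(2 * n.+1) | bits i \in a]%SET.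
have aB : a = region B.
  apply/seteqP; split => [x ax|x [i]].
    have xn : (prefix_code (depth n) x < 2 * n.+1)%N.
      by rewrite [X in (_ < X)%N]n2 prefix_code_lt.
    exists (Ordinal xn) => //; rewrite inE; apply/mem_set.
    by apply: (am0 (depth n)) ax => //=; rewrite prefix_code_bits ?prefix_code_lt.
  rewrite inE => /set_mem ai xi; apply: (am0 (depth n)) ai => //.
  by rewrite prefix_code_bits ?xi// -n2.
have Bn : #|B| = n.+1 by apply/fair_coin_measure_region => //; rewrite -aB.
have BCn : #|(~: B)%SET| = n.+1 by have := cardsC B; rewrite Bn card_ord; lia.
have [|f finj Bf] := @inj_codom_ex n (~: B)%SET; first by rewrite BCn.
exists f => //; rewrite aB; congr (region _).
apply/eqP; rewrite eqEcard card_missed// Bn leqnn andbT.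
apply/fintype.subsetP => i; rewrite inE; apply: contraR => iB.
by apply: Bf; rewrite inE.
Qed.
End HalfClopen.

(** * The reduction *)

Lemma ultra_exists_lt (T : Type) (U : set_system T) (k : nat) (P : nat -> set T) :
  UltraFilter U -> U [set t | exists2 j, (j < k)%N & P j t] ->
  exists2 j, (j < k)%N & U (P j).
Proof.
move=> UU; elim: k => [|k IH] UP.
  by have [t [j]] := filter_ex UP.
have [Uk|UNk] := in_ultra_setVsetC (P k) UU; first by exists k.
have [|j jk Uj] := IH; last by exists j => //; exact: ltnW.
apply: filterS (filterI UP UNk) => t [[j jk Pj] NPk]; exists j => //.
by move: jk; rewrite ltnS leq_eqVlt => /predU1P[jk|//]; rewrite jk in Pj.
Qed.

Definition injections : set bigK :=
  [set p : bigK | two_power (tag p) /\ injective (tagged p : K (tag p).+1)].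

(** A level with [2 ^ k > k] admits an injection whose range contains all the
    [k] points of a candidate cover. *)
Lemma injections_positive (R : realType) : ~ idealM R injections.
Proof.
move=> /idealMP[k /(_ (2 ^ k).-1)[b bk bX]].
have [|f finj bf] := @inj_codom_ex _ b.
  by rewrite (leq_trans bk)// prednK ?expn_gt0// ltnW// ltn_expl.
have [|i ib] := bX f; first by split => //; exact: two_power_predn.
by rewrite bf.
Qed.

Definition half_clopen (R : realType) (p : injections) : Omega R :=
  let: conj p2 pinj := set_valP p in SigSub (mem_set (Omega_missed R p2 pinj)).

Lemma half_clopenE (R : realType) (p : injections) :
  set_val (half_clopen R p) = region (missed (tagged (set_val p))).
Proof. by rewrite /half_clopen; case: (set_valP p). Qed.

Lemma idealS_half_clopen (R : realType) (A : set (Omega R)) :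
  idealS R A -> restrict_ideal (idealM R) injections (half_clopen R @^-1` A).
Proof.
move=> [F /finite_seqP[s ->] As]; apply/idealMP; exists (size s) => n.
pose b := [set i : 'I_(2 * n.+1) | val i \in map (prefix_code (depth n)) s]%SET.
exists b.
  rewrite cardE -(size_map val) -(size_map (prefix_code (depth n)) s).
  apply: uniq_leq_size; first by rewrite (map_inj_uniq val_inj) enum_uniq.
  by move=> _ /mapP[i + ->]; rewrite mem_enum inE.
move=> f [p /= Ap pf]; have [x xs] := As _ Ap.
rewrite /through /= half_clopenE pf => -[/= i]; rewrite inE => fi xi.
by exists i => //; rewrite inE; apply/mapP; exists x.
Qed.

Lemma half_clopen_idealS (R : realType) (A : set (Omega R)) :
  restrict_ideal (idealM R) injections (half_clopen R @^-1` A) -> idealS R A.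
Proof.
move=> /idealMP[k Ak]; pose N m := (2 ^ m).-1.
(* The cover at level [N m], as a list of codes so that its type does not
   depend on [m]. *)
have /choice[b bP] m : exists b : seq nat, [/\ (size b <= k)%N &
    forall f : K (N m).+1, injective f ->
      (exists2 a, A a & set_val a = region (missed f)) ->
    exists2 c, c \in b & region (missed f) (bits c)].
  have [b bk bA] := Ak (N m); exists (map val (enum b)).
  split=> [|f finj [a Aa af]]; first by rewrite size_map -cardE.
  have pX : injections (existT _ (N m) f).
    by split => //; exact: two_power_predn.
  have [|i ib fi] := bA f.
    exists (SigSub (mem_set pX)) => //=.
    have eqa : half_clopen R (SigSub (mem_set pX)) = a.
      apply: val_inj.
      exact: (etrans (half_clopenE R (SigSub (mem_set pX))) (esym af)).
    by rewrite eqa.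
  exists (val i); first by rewrite map_f// mem_enum.
  by apply: region_bits; [exact: two_power_predn|rewrite inE].
have [U [UU ooU]] := ultraFilterLemma eventually_filter.
(* Where [b m] has no [j]-th entry the default 0 stands in: a superfluous
   limit point only enlarges the final cover. *)
have /choice[x xP] (j : nat) : exists x, forall C : set cantor_space,
    closed C -> U [set m | C (bits (nth 0%N (b m) j))] -> C x.
  exact: cantor_limit.
exists (x @` `I_k); first exact/finite_image/finite_II.
move=> a Aa.
have [m0 am0] := Omega_missed_ex (set_valP a).
have [[_ ca] _] := set_valP a.
have [j jk Uj] : exists2 j, (j < k)%N &
    U [set m | set_val a (bits (nth 0%N (b m) j))].
  apply: ultra_exists_lt; apply: ooU; exists m0 => // m /= m0m.
  have [bk bA] := bP m.
  have [||f finj fa] := am0 (N m).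
  - by rewrite depth_predn leqW.
  - exact: two_power_predn.
  have [|c cb] := bA f finj; first by exists a.
  rewrite fa => ac; exists (index c (b m)); last by rewrite nth_index.
  by rewrite (leq_trans _ bk)// index_mem.
by exists (x j); [exists j|exact: xP Uj].
Qed.

Theorem theorem3p14 (R : realType) :
  exists X : set bigK,
    ~ idealM R X /\ RK_le (idealS R) (restrict_ideal (idealM R) X).
Proof.
exists injections; split; first exact: injections_positive.
exists (half_clopen R); apply/seteqP; split => A.
  exact: idealS_half_clopen.
exact: half_clopen_idealS.
Qed.
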